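(* Let $N\in\mathbb{N}$ and let $Q$ be an invertible complex $N\times N$ matrix. The inner autoequivalence $\Phi_Q$ of $YB^1(\mathrm{Mat}^N)$ restricts to an autoequivalence of $YB^1(\mathrm{Match}^N)$ if and only if $Q$ is a monomial matrix.
   Context: $YB^1(\mathrm{Mat}^N)$ is the category whose objects are the invertible complex $N^2\times N^2$ matrices $R$ (acting on $\mathbb{C}^N\otimes\mathbb{C}^N$, written $(1,R)$) satisfying the Yang-Baxter equation $(R\otimes I_N)(I_N\otimes R)(R\otimes I_N)=(I_N\otimes R)(R\otimes I_N)(I_N\otimes R)$, and whose morphisms $(1,R)\to(1,S)$ are the $N\times N$ matrices $f$ with $(f\otimes f)R=S(f\otimes f)$. Write $|w\rangle=|w_1\rangle\otimes\cdots\otimes|w_n\rangle$ for words $w\in\{1,\ldots,N\}^n$, the standard basis of $(\mathbb{C}^N)^{\otimes n}$. An $N^n\times N^n$ matrix $M$ is charge conserving if $\langle w|M|w'\rangle\ne0$ implies that $w$ is a rearrangement (place permutation) of $w'$; in particular for $n=1$ the charge conserving matrices are the diagonal $N\times N$ matrices. $YB^1(\mathrm{Match}^N)$ is the subcategory of $YB^1(\mathrm{Mat}^N)$ whose objects are the $(1,R)$ with $R$ charge conserving and whose morphisms are the $f$ that are charge conserving (i.e. diagonal). For an invertible $N\times N$ matrix $Q$, $\Phi_Q$ is the functor $YB^1(\mathrm{Mat}^N)\to YB^1(\mathrm{Mat}^N)$ given by $\Phi_Q((1,R))=(1,Q^{\otimes2}R(Q^{-1})^{\otimes 2})$ on objects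 and $\Phi_Q(f)=QfQ^{-1}$ on morphisms; it is an autoequivalence naturally isomorphic to the identity (''inner''). $\Phi_Q$ restricts to an autoequivalence of the subcategory if it maps objects and morphisms of the subcategory into the subcategory and the resulting functor is an equivalence. A matrix is monomial if it has exactly one non-zero entry in each row and each column. *)

(* Defs.v *)
From HB Require Import structures.
From mathcomp Require Import all_boot all_order all_algebra.
From mathcomp Require Import mxtens complex reals.

Set Implicit Arguments.
Unset Strict Implicit.
Unset Printing Implicit Defensive.

Import GRing.Theory.
Local Open Scope ring_scope.

Record category := Category {
  obj :> Type;
  hom : obj -> obj -> Type;
  idm : forall x, hom x x;
  comp : forall x y z, hom y z -> hom x y -> hom x z;
  comp1m : forall x y (f : hom x y), comp (idm y) f = f;
  compm1 : forall x y (f : hom x y), comp f (idm x) = f;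
  compA : forall w x y z (h : hom y z) (g : hom x y) (f : hom w x),
    comp h (comp g f) = comp (comp h g) f
}.
Arguments hom {c} x y.
Arguments idm {c} x.
Arguments comp {c x y z} g f.

Record functor (C D : category) := Functor {
  fobj :> C -> D;
  fhom : forall x y : C, hom x y -> hom (fobj x) (fobj y);
  fhom_id : forall x, fhom (idm x) = idm (fobj x);
  fhom_comp : forall x y z (g : hom y z) (f : hom x y),
    fhom (comp g f) = comp (fhom g) (fhom f)
}.
Arguments fhom {C D} _ {x y} _.

Definition id_functor (C : category) : functor C C :=
  @Functor C C id (fun _ _ f => f) (fun _ => erefl) (fun _ _ _ _ _ => erefl).

Lemma comp_functor_id (C D E : category) (G : functor D E) (F : functor C D) x :
  fhom G (fhom F (idm x)) = idm (G (F x)).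
Proof. by rewrite !fhom_id. Qed.

Lemma comp_functor_comp (C D E : category) (G : functor D E) (F : functor C D)
    x y z (g : hom y z) (f : hom x y) :
  fhom G (fhom F (comp g f)) = comp (fhom G (fhom F g)) (fhom G (fhom F f)).
Proof. by rewrite !fhom_comp. Qed.

Definition comp_functor (C D E : category) (G : functor D E) (F : functor C D) :
    functor C E :=
  @Functor C E (fun x => G (F x)) (fun _ _ f => fhom G (fhom F f))
    (comp_functor_id G F) (comp_functor_comp G F).

Definition is_iso (C : category) (x y : C) (f : hom x y) : Prop :=
  exists g : hom y x, comp g f = idm x /\ comp f g = idm y.

Definition naturally_isomorphic (C D : category) (F G : functor C D) : Prop :=
  exists eta : forall x : C, hom (F x) (G x),
    (forall x, is_iso (eta x)) /\
    (forall x y (f : hom x y),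
       comp (eta y) (fhom F f) = comp (fhom G f) (eta x)).

Definition is_equivalence (C D : category) (F : functor C D) : Prop :=
  exists G : functor D C,
    naturally_isomorphic (comp_functor G F) (id_functor C) /\
    naturally_isomorphic (comp_functor F G) (id_functor D).

(* Membership is boolean, so that the morphisms of a subcategory are determined
   by the underlying morphisms. *)
Record subcategory (C : category) := Subcategory {
  sub_obj : pred C;
  sub_hom : forall x y : C, pred (hom x y);
  sub_idm : forall x, sub_obj x -> sub_hom (idm x);
  sub_comp : forall x y z (g : hom y z) (f : hom x y),
    sub_obj x -> sub_obj y -> sub_obj z ->
    sub_hom g -> sub_hom f -> sub_hom (comp g f)
}.
Arguments sub_obj {C} s x.
Arguments sub_hom {C} s {x y} f.

Section SubcategoryCategory.
Variables (C : category) (S : subcategory C).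

Definition subcat_obj : Type := {x : C | sub_obj S x}.

Definition subcat_hom (x y : subcat_obj) : Type :=
  {f : hom (val x) (val y) | sub_hom S f}.

Definition subcat_idm (x : subcat_obj) : subcat_hom x x :=
  exist _ (idm (val x)) (sub_idm (valP x)).

Definition subcat_comp (x y z : subcat_obj)
    (g : subcat_hom y z) (f : subcat_hom x y) : subcat_hom x z :=
  exist _ (comp (val g) (val f))
    (sub_comp (valP x) (valP y) (valP z) (valP g) (valP f)).

Lemma subcat_comp1m x y (f : subcat_hom x y) : subcat_comp (subcat_idm y) f = f.
Proof. by apply: val_inj; apply: comp1m. Qed.

Lemma subcat_compm1 x y (f : subcat_hom x y) : subcat_comp f (subcat_idm x) = f.
Proof. by apply: val_inj; apply: compm1. Qed.

Lemma subcat_compA w x y z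
    (h : subcat_hom y z) (g : subcat_hom x y) (f : subcat_hom w x) :
  subcat_comp h (subcat_comp g f) = subcat_comp (subcat_comp h g) f.
Proof. by apply: val_inj; apply: compA. Qed.

Definition category_of_subcategory : category :=
  Category subcat_comp1m subcat_compm1 subcat_compA.

Definition preserves_subcategory (F : functor C C) : Prop :=
  (forall x, sub_obj S x -> sub_obj S (F x)) /\
  (forall x y (f : hom x y), sub_obj S x -> sub_obj S y ->
     sub_hom S f -> sub_hom S (fhom F f)).

Section Restriction.
Variables (F : functor C C) (FS : preserves_subcategory F).

Definition restrict_obj (x : subcat_obj) : subcat_obj :=
  exist _ (F (val x)) (FS.1 (val x) (valP x)).

Definition restrict_hom (x y : subcat_obj) (f : subcat_hom x y) :
    subcat_hom (restrict_obj x) (restrict_obj y) :=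
  exist _ (fhom F (val f)) (FS.2 _ _ (val f) (valP x) (valP y) (valP f)).

Lemma restrict_hom_id x :
  restrict_hom (subcat_idm x) = subcat_idm (restrict_obj x).
Proof. by apply: val_inj; apply: fhom_id. Qed.

Lemma restrict_hom_comp x y z (g : subcat_hom y z) (f : subcat_hom x y) :
  restrict_hom (subcat_comp g f) =
  subcat_comp (restrict_hom g) (restrict_hom f).
Proof. by apply: val_inj; apply: fhom_comp. Qed.

Definition restrict_functor :
    functor category_of_subcategory category_of_subcategory :=
  @Functor category_of_subcategory category_of_subcategory
    restrict_obj restrict_hom restrict_hom_id restrict_hom_comp.

End Restriction.

Definition restricts_to_autoequivalence (F : functor C C) : Prop :=
  exists FS : preserves_subcategory F, is_equivalence (restrict_functor FS).

End SubcategoryCategory.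

(* The position of |w> = |w_1> (x) ... (x) |w_n> in the standard basis of the
   n-fold tensor power, compatibly with the tensor product tensmx. *)
Fixpoint word_index (N n : nat) : n.-tuple 'I_N -> 'I_(N ^ n) :=
  match n return n.-tuple 'I_N -> 'I_(N ^ n) with
  | 0 => fun _ => (ord0 : 'I_1)
  | n'.+1 => fun w => cast_ord (esym (expnS N n'))
      (mxtens_index (thead w, word_index (behead_tuple w)))
  end.

Lemma word_index_inj N n : injective (@word_index N n).
Proof.
elim: n => [|n IHn] w w'; first by move=> _; rewrite (tuple0 w) (tuple0 w').
move=> /cast_ord_inj /(can_inj (@mxtens_indexK _ _)) [ww' /IHn /(congr1 val) /= ww'_tl].
by rewrite (tuple_eta w) (tuple_eta w'); apply: val_inj; rewrite /= ww' ww'_tl.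
Qed.

Lemma word_index_surj N n (i : 'I_(N ^ n)) :
  exists w : n.-tuple 'I_N, word_index w = i.
Proof.
have: i \in codom (@word_index N n).
  apply: inj_card_onto; first exact: word_index_inj.
  by rewrite card_tuple !card_ord.
by case/codomP=> w ->; exists w.
Qed.

Lemma word_index1 N (i : 'I_N) : word_index [tuple i] = i :> 'I_N.
Proof. by apply: val_inj; rewrite /= muln1 addn0. Qed.

Lemma word_index2 N (i j : 'I_N) :
  word_index [tuple i; j] = mxtens_index (i, j) :> 'I_(N * N).
Proof. by apply: val_inj; rewrite /= muln1 addn0. Qed.

Section YangBaxter.
Variable F : fieldType.

Definition charge_conserving (N n : nat) (M : 'M[F]_(N ^ n)) : bool :=
  [forall w : n.-tuple 'I_N, forall w' : n.-tuple 'I_N,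
     (M (word_index w) (word_index w') != 0) ==> perm_eq w w'].

Lemma charge_conserving_diag N (f : 'M[F]_N) :
  @charge_conserving N 1 f = is_diag_mx f.
Proof.
apply/'forall_forallP/is_diag_mxP => [cf i j neq_ij | df w w'].
  apply/eqP; have /implyP := cf [tuple i] [tuple j].
  rewrite !word_index1 => /contraNT; apply.
  by apply: contra neq_ij => /perm_mem/(_ i); rewrite !inE eqxx => /esym/eqP->.
apply/implyP; case: (tupleP w) => i w1; case: (tupleP w') => j w1'.
rewrite (tuple0 w1) (tuple0 w1') !word_index1.
by apply: contraR => nij; rewrite df //; apply: contra nij => /eqP/val_inj->.
Qed.

Definition monomial_mx (N : nat) (Q : 'M[F]_N) : bool :=
  [forall i, #|[pred j | Q i j != 0]| == 1%N] &&
  [forall j, #|[pred i | Q i j != 0]| == 1%N].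

Lemma charge_conserving1 N n : charge_conserving (1%:M : 'M[F]_(N ^ n)).
Proof.
apply/'forall_forallP => w w'; apply/implyP; rewrite mxE.
by have [/word_index_inj -> //|_] := eqVneq (word_index w) (word_index w');
  rewrite eqxx.
Qed.

Lemma charge_conserving_mul N n (A B : 'M[F]_(N ^ n)) :
  charge_conserving A -> charge_conserving B -> charge_conserving (A *m B).
Proof.
move=> /'forall_forallP cA /'forall_forallP cB.
apply/'forall_forallP => w w'; apply/implyP; apply: contraR => nww'.
rewrite mxE big1 // => k _; have [u <-] := word_index_surj k.
have /implyP cAwu := cA w u; have /implyP cBuw := cB u w'.
have [->|/cAwu wu] := eqVneq (A (word_index w) (word_index u)) 0.
  by rewrite mul0r.
have [->|/cBuw uw] := eqVneq (B (word_index u) (word_index w')) 0.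
  by rewrite mulr0.
by rewrite (perm_trans wu uw) in nww'.
Qed.

Section Categories.
Variable N : nat.
Implicit Types (f g A B : 'M[F]_N) (R S : 'M[F]_(N * N)).

(* Identifies V (x) (V (x) V) with (V (x) V) (x) V. *)
Definition assoc_mx (A : 'M[F]_(N * (N * N))) : 'M[F]_(N * N * N) :=
  castmx (mulnA N N N, mulnA N N N) A.

Definition yang_baxter R : bool :=
  let R12 := R *t (1%:M : 'M[F]_N) in
  let R23 := assoc_mx ((1%:M : 'M[F]_N) *t R) in
  R12 *m R23 *m R12 == R23 *m R12 *m R23.

Definition intertwines R S f : bool := (f *t f) *m R == S *m (f *t f).

Definition YB_obj : Type :=
  {R : 'M[F]_(N * N) | (R \in unitmx) && yang_baxter R}.

Definition YB_hom (R S : YB_obj) : Type :=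
  {f : 'M[F]_N | intertwines (val R) (val S) f}.

Lemma tensmx11 m n : (1%:M : 'M[F]_m) *t (1%:M : 'M[F]_n) = 1%:M.
Proof.
apply/matrixP => i j; case: (mxtens_indexP i) => i1 i2.
case: (mxtens_indexP j) => j1 j2; rewrite tensmxE !mxE.
by rewrite (can_eq (@mxtens_indexK _ _)) xpair_eqE -natrM mulnb.
Qed.

Lemma intertwines1 R : intertwines R R 1%:M.
Proof. by rewrite /intertwines tensmx11 mulmx1 mul1mx. Qed.

Lemma intertwines_mul R S T g f :
  intertwines S T g -> intertwines R S f -> intertwines R T (g *m f).
Proof.
move=> /eqP eg /eqP ef; apply/eqP.
by rewrite -tensmx_mul -mulmxA ef mulmxA eg mulmxA.
Qed.

Definition YB_idm (R : YB_obj) : YB_hom R R :=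
  exist _ 1%:M (intertwines1 (val R)).

Definition YB_comp (R S T : YB_obj) (g : YB_hom S T) (f : YB_hom R S) :
    YB_hom R T :=
  exist _ (val g *m val f) (intertwines_mul (valP g) (valP f)).

Lemma YB_comp1m (R S : YB_obj) (f : YB_hom R S) : YB_comp (YB_idm S) f = f.
Proof. by apply: val_inj; apply: mul1mx. Qed.

Lemma YB_compm1 (R S : YB_obj) (f : YB_hom R S) : YB_comp f (YB_idm R) = f.
Proof. by apply: val_inj; apply: mulmx1. Qed.

Lemma YB_compA (R S T U : YB_obj)
    (h : YB_hom T U) (g : YB_hom S T) (f : YB_hom R S) :
  YB_comp h (YB_comp g f) = YB_comp (YB_comp h g) f.
Proof. by apply: val_inj; apply: mulmxA. Qed.

Definition YB1_Mat : category := Category YB_comp1m YB_compm1 YB_compA.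

Definition match_obj (R : YB1_Mat) : bool := @charge_conserving N 2 (val R).

Definition match_hom (R S : YB1_Mat) (f : hom R S) : bool :=
  @charge_conserving N 1 (val f).

Lemma match_idm (R : YB1_Mat) : match_obj R -> match_hom (idm R).
Proof. by move=> _; apply: charge_conserving1. Qed.

Lemma match_comp (R S T : YB1_Mat) (g : hom S T) (f : hom R S) :
  match_obj R -> match_obj S -> match_obj T ->
  match_hom g -> match_hom f -> match_hom (comp g f).
Proof. by move=> _ _ _; apply: charge_conserving_mul. Qed.

Definition YB1_Match : subcategory YB1_Mat := Subcategory match_idm match_comp.

Section InnerFunctor.
Variables (Q : 'M[F]_N) (hQ : Q \in unitmx).

Definition Phi_mx R : 'M[F]_(N * N) :=
  (Q *t Q) *m R *m (invmx Q *t invmx Q).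

Lemma tensmx_VK : (invmx Q *t invmx Q) *m (Q *t Q) = 1%:M.
Proof. by rewrite tensmx_mul mulVmx // tensmx11. Qed.

Lemma tensmx_KV : (Q *t Q) *m (invmx Q *t invmx Q) = 1%:M.
Proof. by rewrite tensmx_mul mulmxV // tensmx11. Qed.

Lemma Phi_mx_unit R : R \in unitmx -> Phi_mx R \in unitmx.
Proof.
have [uV uQ] := mulmx1_unit tensmx_VK.
by move=> uR; rewrite !unitmx_mul uQ uR uV.
Qed.

Lemma assoc_mx_mul (A B : 'M[F]_(N * (N * N))) :
  assoc_mx (A *m B) = assoc_mx A *m assoc_mx B.
Proof. by rewrite /assoc_mx; case: _ / (mulnA N N N); rewrite !castmx_id. Qed.

Lemma assoc_tensmx f g A : assoc_mx (f *t (g *t A)) = f *t g *t A.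
Proof.
apply/matrixP => i j.
case: (mxtens_indexP i) => i12 i3; case: (mxtens_indexP i12) => i1 i2.
case: (mxtens_indexP j) => j12 j3; case: (mxtens_indexP j12) => j1 j2.
have castE (a b c : 'I_N) :
    cast_ord (esym (mulnA N N N)) (mxtens_index (mxtens_index (a, b), c))
    = mxtens_index (a, mxtens_index (b, c)).
  by apply: val_inj; rewrite /= mulnDl -mulnA addnA.
by rewrite castmxE !castE !tensmxE mulrA.
Qed.

Let Q3 : 'M[F]_(N * N * N) := Q *t Q *t Q.
Let V3 : 'M[F]_(N * N * N) := invmx Q *t invmx Q *t invmx Q.

Lemma Phi_mx12 R :
  Phi_mx R *t (1%:M : 'M[F]_N) = Q3 *m (R *t (1%:M : 'M[F]_N)) *m V3.
Proof. by rewrite !tensmx_mul mulmx1 mulmxV. Qed.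

Lemma Phi_mx23 R :
  assoc_mx ((1%:M : 'M[F]_N) *t Phi_mx R) =
  Q3 *m assoc_mx ((1%:M : 'M[F]_N) *t R) *m V3.
Proof.
by rewrite /Q3 /V3 -!assoc_tensmx -!assoc_mx_mul !tensmx_mul mulmx1 mulmxV.
Qed.

Lemma Phi_mx_yang_baxter R : yang_baxter R -> yang_baxter (Phi_mx R).
Proof.
rewrite /yang_baxter Phi_mx12 Phi_mx23 => /eqP e; apply/eqP.
have VQ : V3 *m Q3 = 1%:M by rewrite !tensmx_mul !mulVmx // !tensmx11.
have conj3 (A B C : 'M[F]_(N * N * N)) :
    (Q3 *m A *m V3) *m (Q3 *m B *m V3) *m (Q3 *m C *m V3)
    = Q3 *m (A *m B *m C) *m V3.
  by rewrite !mulmxA -(mulmxA _ V3 Q3) VQ mulmx1 -(mulmxA _ V3 Q3) VQ mulmx1.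
by rewrite !conj3 e.
Qed.

Lemma Phi_objP (R : YB_obj) :
  (Phi_mx (val R) \in unitmx) && yang_baxter (Phi_mx (val R)).
Proof.
by have /andP[uR yR] := valP R; rewrite Phi_mx_unit // Phi_mx_yang_baxter.
Qed.

Definition Phi_obj (R : YB1_Mat) : YB1_Mat := exist _ (Phi_mx (val R)) (Phi_objP R).

Lemma Phi_homP (R S : YB_obj) (f : YB_hom R S) :
  intertwines (Phi_mx (val R)) (Phi_mx (val S)) (Q *m val f *m invmx Q).
Proof.
have /eqP e := valP f; apply/eqP; rewrite -!tensmx_mul /Phi_mx !mulmxA.
rewrite -(mulmxA _ _ (Q *t Q)) tensmx_VK mulmx1.
rewrite -(mulmxA _ _ (val R)) e.
by rewrite -(mulmxA _ _ (Q *t Q)) tensmx_VK mulmx1 !mulmxA.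
Qed.

Definition Phi_hom (R S : YB1_Mat) (f : hom R S) :
    hom (Phi_obj R) (Phi_obj S) :=
  exist _ (Q *m val f *m invmx Q) (Phi_homP f).

Lemma Phi_hom_id (R : YB1_Mat) : Phi_hom (idm R) = idm (Phi_obj R).
Proof. by apply: val_inj; rewrite /= mulmx1 mulmxV. Qed.

Lemma Phi_hom_comp (R S T : YB1_Mat) (g : hom S T) (f : hom R S) :
  Phi_hom (comp g f) = comp (Phi_hom g) (Phi_hom f).
Proof.
by apply: val_inj; rewrite /= !mulmxA -(mulmxA _ (invmx Q) Q) mulVmx // mulmx1.
Qed.

Definition Phi : functor YB1_Mat YB1_Mat :=
  @Functor YB1_Mat YB1_Mat Phi_obj Phi_hom Phi_hom_id Phi_hom_comp.

End InnerFunctor.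
End Categories.
End YangBaxter.

(* Main.v *)
Require Import Defs.
From HB Require Import structures.
From mathcomp Require Import all_boot all_order all_algebra.
From mathcomp Require Import mxtens complex reals.

Set Implicit Arguments.
Unset Strict Implicit.
Unset Printing Implicit Defensive.

Import GRing.Theory.
Local Open Scope ring_scope.

(** The identity matrix is an object whose endomorphisms in YB1_Match are all
    the diagonal matrices, so if Phi_Q restricts then Q D Q^-1 is diagonal for
    every diagonal D.  With D = E_ii this says that the rank one matrix
    (column i of Q) (row i of Q^-1) is diagonal, hence column i of Q has a single
    nonzero entry; two columns supported at the same place would be
    proportional.  Conversely a monomial Q acts on words, up to scalars, by a
    permutation of the letters, which commutes with place permutations; so does
    Q^-1, and Phi_Q, Phi_(Q^-1) restrict to mutually inverse functors. *)

Section Sparse.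
Variables (F : fieldType) (N : nat).
Implicit Types (P Q : 'M[F]_N).

Lemma mulmx_neq0 m n p (A : 'M[F]_(m, n)) (B : 'M[F]_(n, p)) i k :
  (A *m B) i k != 0 -> exists j, A i j != 0 /\ B j k != 0.
Proof.
move=> AB0; suff /existsP[j /andP[]]: [exists j, (A i j != 0) && (B j k != 0)].
  by exists j.
apply: contraNT AB0 => /existsPn AB0; rewrite mxE big1 // => j _.
by apply/eqP; rewrite mulf_eq0 -[_ || _]negbK negb_or.
Qed.

Lemma mulmx1_neq0 P Q i :
  P *m Q = 1%:M -> exists j, P i j != 0 /\ Q j i != 0.
Proof. by move=> PQ; apply: mulmx_neq0; rewrite PQ mxE eqxx oner_eq0. Qed.

Definition row_sparse Q := forall i j k, Q i j != 0 -> Q i k != 0 -> j = k.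

Definition col_sparse Q := forall i j k, Q i k != 0 -> Q j k != 0 -> i = j.

(** Invertibility already gives a nonzero entry in every row and every column, so only the upper
    bounds on their number remain to be expressed. *)
Lemma monomial_mxP Q : Q \in unitmx ->
  reflect (row_sparse Q /\ col_sparse Q) (monomial_mx Q).
Proof.
move=> uQ; apply: (iffP andP) => [[/forallP rQ /forallP cQ]|[rQ cQ]].
  split=> [i j k|i j k] Q1 Q2.
    by have /eqP/eq_leq/card_le1_eqP le1 := rQ i; apply: le1.
  by have /eqP/eq_leq/card_le1_eqP le1 := cQ k; apply: le1.
split; apply/forallP => i; rewrite eqn_leq; apply/andP; split.
- by apply/card_le1_eqP => j k /= ji ki; apply: rQ ki ji.
- have [j [Qij _]] := mulmx1_neq0 i (mulmxV uQ).
  by apply/card_gt0P; exists j.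
- by apply/card_le1_eqP => j k /= ji ki; apply: cQ ki ji.
- have [j [_ Qji]] := mulmx1_neq0 i (mulVmx uQ).
  by apply/card_gt0P; exists j.
Qed.

(** Column [k] of [Q] has no nonzero entry other than [Q j k], so nothing can cancel [P i j * Q j k]
    in the [(i, k)] entry of the identity. *)
Lemma inv_supports_meet P Q i j k :
  P *m Q = 1%:M -> col_sparse Q -> P i j != 0 -> Q j k != 0 -> i = k.
Proof.
move=> PQ cQ Pij Qjk; apply/eqP; apply: contraT => nik.
have /eqP := congr1 (fun A : 'M_N => A i k) PQ.
rewrite !mxE (bigD1 j) //= big1 => [|b nbj].
  by rewrite addr0 (negbTE nik) mulf_eq0 (negbTE Pij) (negbTE Qjk).
have [->|/cQ/(_ Qjk) bj] := eqVneq (Q b k) 0; first by rewrite mulr0.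
by rewrite bj eqxx in nbj.
Qed.

(** Row [j] of [Q] is nonzero at some [k], and [inv_supports_meet] forces [k = i]: the inverse lives
    on the transposed support. *)
Lemma inv_support P Q i j :
  P *m Q = 1%:M -> col_sparse Q -> P i j != 0 -> Q j i != 0.
Proof.
move=> PQ cQ Pij; have [k [Qjk _]] := mulmx1_neq0 j (mulmx1C PQ).
by rewrite (inv_supports_meet PQ cQ Pij Qjk).
Qed.

Lemma perm_eq2P (T : eqType) (i j k l : T) :
  reflect ((i = k /\ j = l) \/ (i = l /\ j = k))
    (perm_eq [:: i; j] [:: k; l]).
Proof.
have perm1 (x y : T) : perm_eq [:: x] [:: y] -> x = y.
  by move/(perm_small_eq (isT : (size [:: y] <= 1)%N)) => [].
apply: (iffP idP) => [ijkl|]; last first.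
  by case=> -[-> ->] //; rewrite -(perm_rot 1).
have: i \in [:: k; l] by rewrite -(perm_mem ijkl) mem_head.
rewrite !inE => /orP[]/eqP ik; subst i; [left | right].
  by move: ijkl; rewrite perm_cons => /perm1.
(* Rotating the second word brings the common letter to its front, where it cancels. *)
move: ijkl; rewrite perm_sym -(perm_rot 1) perm_sym perm_cons.
by move/perm1.
Qed.

Lemma charge_conserving2P (M : 'M[F]_(N * N)) :
  reflect (forall i j k l,
      M (mxtens_index (i, j)) (mxtens_index (k, l)) != 0 ->
      (i = k /\ j = l) \/ (i = l /\ j = k))
    (@charge_conserving F N 2 M).
Proof.
apply: (iffP 'forall_forallP) => cM.
  move=> i j k l; rewrite -!word_index2 => Mijkl.
  by apply/perm_eq2P; have /implyP := cM [tuple i; j] [tuple k; l]; apply.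
move=> w w'.
case: (tupleP w) => i w1; case: (tupleP w1) => j w2; rewrite (tuple0 w2).
case: (tupleP w') => k w1'; case: (tupleP w1') => l w2'; rewrite (tuple0 w2').
apply/implyP => Mijkl; apply/perm_eq2P; apply: cM.
by rewrite -!word_index2.
Qed.

Lemma tensmx_neq0 P Q i j k l :
  (P *t Q) (mxtens_index (i, j)) (mxtens_index (k, l)) != 0 ->
  P i k != 0 /\ Q j l != 0.
Proof. by rewrite tensmxE mulf_eq0 negb_or => /andP. Qed.

End Sparse.

Section Inner.
Variables (F : fieldType) (N : nat).
Implicit Types (P Q : 'M[F]_N).

(** A nonzero entry of the triple product yields a path of nonzero entries [(i, j)], [(a, b)],
    [(c, d)], [(k, l)]. The middle step keeps or swaps the two letters, and the outer steps use the
    same relabelling of letters, one in each direction. *)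
Lemma Phi_mx_charge_conserving Q (M : 'M[F]_(N * N)) :
  Q \in unitmx -> col_sparse Q -> @charge_conserving F N 2 M ->
  @charge_conserving F N 2 (Phi_mx Q M).
Proof.
move=> uQ cQ /charge_conserving2P cM; apply/charge_conserving2P => i j k l.
move=> /mulmx_neq0[y []] /mulmx_neq0[x []].
case: (mxtens_indexP x) => a b; case: (mxtens_indexP y) => c d.
move=> /tensmx_neq0[ia jb] /cM abcd /tensmx_neq0[].
move=> /(inv_support (mulVmx uQ) cQ) kc.
move=> /(inv_support (mulVmx uQ) cQ) ld.
case: abcd => -[? ?]; subst c d; [left | right].
  by split; [apply: cQ ia kc | apply: cQ jb ld].
by split; [apply: cQ ia ld | apply: cQ jb kc].
Qed.

Lemma conj_diag Q (D : 'M[F]_N) :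
  Q \in unitmx -> col_sparse Q -> is_diag_mx D ->
  is_diag_mx (Q *m D *m invmx Q).
Proof.
move=> uQ cQ /is_diag_mxP dD; apply/is_diag_mxP => i j nij; apply/eqP.
apply: contraNT nij => /mulmx_neq0[b []] /mulmx_neq0[a [ia ab]].
move=> /(inv_support (mulVmx uQ) cQ) jb.
have eab : a = b.
  by apply/val_inj/eqP; apply: contraNT ab => /dD ->.
by subst b; rewrite (cQ _ _ _ ia jb).
Qed.

Lemma Phi_preserves_match Q (hQ : Q \in unitmx) :
  col_sparse Q -> preserves_subcategory (YB1_Match F N) (Phi hQ).
Proof.
move=> cQ; split=> [R|R S f _ _] /=.
  exact: Phi_mx_charge_conserving.
by rewrite /match_hom !charge_conserving_diag; apply: conj_diag.
Qed.

Lemma sparse_of_conj_diag Q :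
  Q \in unitmx ->
  (forall D, is_diag_mx D -> is_diag_mx (Q *m D *m invmx Q)) ->
  row_sparse Q /\ col_sparse Q.
Proof.
move=> uQ dQ.
have Q0 i a b : a != b -> Q a i * invmx Q i b = 0.
  move=> nab; have: is_diag_mx (delta_mx i i : 'M[F]_N).
    apply/is_diag_mxP => j k njk; rewrite mxE.
    have [ji|//] := eqVneq j i; have [ki|//] := eqVneq k i.
    by rewrite ji ki eqxx in njk.
  move=> /dQ/is_diag_mxP/(_ a b nab).
  (* Factoring [delta_mx i i] through dimension one turns its conjugate into column [i] of [Q] times
     row [i] of [invmx Q]. *)
  by rewrite -(mul_delta_mx (0 : 'I_1)) mulmxA -colE -mulmxA -rowE mxE
    big_ord1 !mxE => <-.
have cQ : col_sparse Q.
  move=> a b i Qai Qbi; have [c [Vic _]] := mulmx1_neq0 i (mulVmx uQ).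
  (* Since [invmx Q i c] is nonzero, [Q0] kills every entry of column [i] of [Q] outside row [c]. *)
  have cE x : Q x i != 0 -> x = c.
    move=> Qxi; apply/eqP; apply: contraT => /(Q0 i)/eqP.
    by rewrite mulf_eq0 (negbTE Qxi) (negbTE Vic).
  by rewrite (cE a) // (cE b).
split=> // a i j Qai Qaj.
have [b [Vib Qbi]] := mulmx1_neq0 i (mulVmx uQ).
(* Now [invmx Q i a] and [Q a j] are both nonzero, which [inv_supports_meet] allows only for
   [i = j]. *)
have Eab := cQ _ _ _ Qai Qbi; subst b.
exact: inv_supports_meet (mulVmx uQ) cQ Vib Qaj.
Qed.

Lemma monomial_of_preserves_match Q (hQ : Q \in unitmx) :
  preserves_subcategory (YB1_Match F N) (Phi hQ) -> monomial_mx Q.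
Proof.
move=> [_ pQ]; apply/(monomial_mxP hQ)/(sparse_of_conj_diag hQ) => D dD.
have ob1 : ((1%:M : 'M[F]_(N * N)) \in unitmx) && @yang_baxter F N 1%:M.
  have assoc1 : assoc_mx (1%:M : 'M[F]_(N * (N * N))) = 1%:M.
    by rewrite -!tensmx11 assoc_tensmx.
  by rewrite unitmx1 /yang_baxter !tensmx11 assoc1 !mulmx1 eqxx.
pose I : YB1_Mat F N := exist _ 1%:M ob1.
have intD : intertwines (val I) (val I) D.
  by rewrite /intertwines /= mulmx1 mul1mx.
pose f : Defs.hom I I := exist _ D intD.
have cI : sub_obj (YB1_Match F N) I by apply: charge_conserving1.
have := pQ I I f cI cI.
by rewrite /= /match_hom !charge_conserving_diag; apply.
Qed.

Lemma Phi_mxK P Q (M : 'M[F]_(N * N)) :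
  Q \in unitmx -> P *m Q = 1%:M -> Phi_mx P (Phi_mx Q M) = M.
Proof.
move=> uQ PQ; have -> : P = invmx Q by rewrite -[P](mulmxK uQ) PQ mul1mx.
rewrite /Phi_mx invmxK !mulmxA tensmx_VK // mul1mx.
by rewrite -mulmxA tensmx_VK // mulmx1.
Qed.

Local Notation Match := (category_of_subcategory (YB1_Match F N)).

(** Both layers of a morphism are boolean subtypes, so equations between morphisms reduce to
    equations between these matrices. *)
Definition hom_mx (x y : Match) (f : Defs.hom x y) : 'M[F]_N := val (val f).

Lemma hom_mx_inj (x y : Match) : injective (@hom_mx x y).
Proof. by move=> f g fg; do 2!apply: val_inj. Qed.

Lemma hom_mx_comp (x y z : Match) (g : Defs.hom y z) (f : Defs.hom x y) :
  hom_mx (Defs.comp g f) = hom_mx g *m hom_mx f.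
Proof. by []. Qed.

Lemma hom_mx_restrict_Phi Q (hQ : Q \in unitmx)
    (pQ : preserves_subcategory (YB1_Match F N) (Phi hQ))
    (x y : Match) (f : Defs.hom x y) :
  hom_mx (fhom (restrict_functor pQ) f) = Q *m hom_mx f *m invmx Q.
Proof. exact: erefl. Qed.

(** Stands in for an identity morphism between objects that share a matrix, avoiding transport along
    an equality of objects. The sigma type lets it serve as the component of a natural
    transformation. *)
Lemma id_hom_of_eq (x y : Match) :
  val (val x) = val (val y) -> {f : Defs.hom x y | hom_mx f = 1%:M}.
Proof.
move=> xy.
have i1 : intertwines (val (val x)) (val (val y)) 1%:M.
  by rewrite xy; apply: intertwines1.
pose f : @Defs.hom (YB1_Mat F N) (val x) (val y) := exist _ 1%:M i1.
have m1 : sub_hom (YB1_Match F N) f by apply: charge_conserving1.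
by exists (exist (fun g => sub_hom (YB1_Match F N) g) f m1).
Qed.

Lemma is_iso_hom_mx1 (x y : Match) (f : Defs.hom x y) :
  val (val x) = val (val y) -> hom_mx f = 1%:M -> is_iso f.
Proof.
move=> xy f1; have [g g1] := id_hom_of_eq (esym xy).
by exists g; split; apply: hom_mx_inj; rewrite hom_mx_comp f1 g1 mulmx1.
Qed.

Lemma comp_restrict_Phi_iso P Q (hP : P \in unitmx) (hQ : Q \in unitmx)
    (pP : preserves_subcategory (YB1_Match F N) (Phi hP))
    (pQ : preserves_subcategory (YB1_Match F N) (Phi hQ)) :
  P *m Q = 1%:M ->
  naturally_isomorphic
    (comp_functor (restrict_functor pP) (restrict_functor pQ))
    (id_functor Match).
Proof.
move=> PQ; set G := comp_functor _ _.
have PhiK x : val (val (G x)) = val (val x) by apply: Phi_mxK.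
exists (fun x => sval (id_hom_of_eq (PhiK x))); split=> [x|x y f].
  exact: is_iso_hom_mx1 (PhiK x) (svalP (id_hom_of_eq (PhiK x))).
apply: hom_mx_inj; rewrite !hom_mx_comp.
rewrite (svalP (id_hom_of_eq (PhiK x))) (svalP (id_hom_of_eq (PhiK y))).
rewrite mul1mx mulmx1 !hom_mx_restrict_Phi.
have -> : P = invmx Q by rewrite -[P](mulmxK hQ) PQ mul1mx.
by rewrite invmxK !mulmxA mulVmx // mul1mx -mulmxA mulVmx // mulmx1.
Qed.

End Inner.

Theorem theorem7p18 (R : realType) (N : nat) (Q : 'M[R[i]]_N)
    (hQ : Q \in unitmx) :
  restricts_to_autoequivalence (YB1_Match R[i] N) (Phi hQ) <-> monomial_mx Q.
Proof.
split=> [[pQ _]|mQ]; first exact: monomial_of_preserves_match.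
have [rQ cQ] := monomial_mxP hQ mQ.
have pQ := Phi_preserves_match hQ cQ.
have hV : invmx Q \in unitmx by rewrite unitmx_inv.
(* Passing to the inverse transposes supports, so rows of [Q] control columns of [invmx Q]. *)
have cV : col_sparse (invmx Q).
  move=> i j k ik jk.
  by apply: rQ (inv_support (mulVmx hQ) cQ ik) (inv_support (mulVmx hQ) cQ jk).
have pV := Phi_preserves_match hV cV.
exists pQ, (restrict_functor pV); split; apply: comp_restrict_Phi_iso.
  exact: mulVmx.
exact: mulmxV.
Qed.
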